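(* Let $Q=\{(x,y)\in[0,1]^n\times[0,1]^n \mid \sum_{i=1}^n a_ix_iy_i\ge d\}$ be a separable bipartite bilinear set, with $d\in\mathbb{R}$ and $a_i\in\mathbb{R}$ for $i\in[n]$, and let $\Lambda=\{I,J_0,J_1\}$ be a partition of $[n]$. Let $h:[0,1]^{2|I|}\to\mathbb{R}$ be a concave function and $r\in\mathbb{R}$ such that $h(x_I,y_I)\ge r$ is a valid inequality for $\{(x,y)\in Q\mid x_{J_0}=y_{J_0}=0,\ x_{J_1}=y_{J_1}=1\}$, and let $\phi$ be the lifting function of this (seed) inequality. Assume there exist $\psi:\mathbb{R}\to\mathbb{R}$ and concave functions $\gamma_i:\mathbb{R}^2\to\mathbb{R}$ for $i\in J_0\cup J_1$ such that (i) $\psi(\delta)\ge\phi(\delta)$ for all $\delta\in\mathbb{R}$; (ii) $\psi$ is subadditive (i.e., $\psi(\delta_1)+\psi(\delta_2)\ge\psi(\delta_1+\delta_2)$ for all $\delta_1,\delta_2\in\mathbb{R}$) with $\psi(0)=0$; (iii) for $i\in J_0$, $\gamma_i(x,y)\ge\psi(a_ixy)$ for all $(x,y)\in[0,1]^2$; (iv) for $i\in J_1$, $\gamma_i(x,y)\ge\psi(a_ixy-a_i)$ for all $(x,y)\in[0,1]^2$. Then the lifted inequality $$h(x_I,y_I)+\sum_{i\in J_0\cup J_1}\gamma_i(x_i,y_i)\ge r$$ is a valid convex inequality for $Q$, i.e., it is satisfied by every $(x,y)\in Q$ and its left-hand side is a concave function.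
   Context: $[n]=\{1,\dots,n\}$; $x_I$ is the subvector of $x$ indexed by $I$. A partition $\{I,J_0,J_1\}$ of $[n]$ means $I\cup J_0\cup J_1=[n]$ with $I,J_0,J_1$ pairwise disjoint. An inequality is valid for a set if every point of the set satisfies it. The lifting function of the seed inequality $h(x_I,y_I)\ge r$ is defined, for $\delta\in\mathbb{R}$, by $$\phi(\delta)=\max\Big\{r-h(x_I,y_I)\ \Big|\ \sum_{i\in I}a_ix_iy_i\ge\Big(d-\sum_{i\in J_1}a_i\Big)-\delta,\ (x_I,y_I)\in[0,1]^{2|I|}\Big\},$$ with $\phi(\delta)=-\infty$ if the problem is infeasible. *)

(* Defs.v *)
From HB Require Import structures.
From mathcomp Require Import all_boot all_order all_algebra.
From mathcomp Require Import all_classical all_reals all_analysis.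

Set Implicit Arguments.
Unset Strict Implicit.
Unset Printing Implicit Defensive.

Import Order.TTheory GRing.Theory Num.Theory.

Local Open Scope classical_set_scope.
Local Open Scope ring_scope.

Definition concave_function (R : numFieldType) (E : lmodType R)
    (D : set E) (f : E -> R) : Prop :=
  convex_function (D : set (convex_lmodType E)) (fun x => - f x).

Definition valid_ineq (R : realType) (T : Type) (S : set T) (f : T -> R)
    (r : R) : Prop :=
  forall p, S p -> r <= f p.

(* Some of the three parts may be empty, unlike in [finset.partition]. *)
Definition partition3 (T : finType) (I J0 J1 : {set T}) : Prop :=
  [/\ (I :|: J0 :|: J1)%SET = [set: T]%SET,
      [disjoint I & J0]%B, [disjoint I & J1]%B & [disjoint J0 & J1]%B].

Definition cube2 (R : realType) (n : nat) : set ('rV[R]_n * 'rV[R]_n) :=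
  [set p : 'rV[R]_n * 'rV[R]_n |
    forall i, 0 <= p.1 0 i <= 1 /\ 0 <= p.2 0 i <= 1].

(* x_I, with the indices of I listed in increasing order *)
Definition subvec (R : realType) (n : nat) (I : {set 'I_n}) (x : 'rV[R]_n) :
  'rV[R]_#|I| := \row_j x 0 (enum_val j).

Definition subvec2 (R : realType) (n : nat) (I : {set 'I_n})
    (p : 'rV[R]_n * 'rV[R]_n) : 'rV[R]_#|I| * 'rV[R]_#|I| :=
  (subvec I p.1, subvec I p.2).

Definition bilinear_set (R : realType) (n : nat) (a : 'rV[R]_n) (d : R) :
    set ('rV[R]_n * 'rV[R]_n) :=
  [set p : 'rV[R]_n * 'rV[R]_n |
    cube2 p /\ d <= \sum_i a 0 i * p.1 0 i * p.2 0 i].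

Definition bilinear_restr (R : realType) (n : nat) (a : 'rV[R]_n) (d : R)
    (J0 J1 : {set 'I_n}) : set ('rV[R]_n * 'rV[R]_n) :=
  [set p : 'rV[R]_n * 'rV[R]_n | [/\ bilinear_set a d p,
      forall i, i \in J0 -> p.1 0 i = 0 /\ p.2 0 i = 0 &
      forall i, i \in J1 -> p.1 0 i = 1 /\ p.2 0 i = 1]].

(* The supremum is -oo over an empty feasible set.  Over a nonempty one it is
   an attained maximum when h is concave on the cube: such an h is lower
   semicontinuous there and the feasible set is compact. *)
Definition lifting_fun (R : realType) (n : nat) (a : 'rV[R]_n) (d : R)
    (I J1 : {set 'I_n}) (h : 'rV[R]_#|I| * 'rV[R]_#|I| -> R) (r : R)
    (delta : R) : \bar R :=
  ereal_sup [set (r - h q)%:E | q in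
    [set q : 'rV[R]_#|I| * 'rV[R]_#|I| | cube2 q /\
      (d - \sum_(i in J1) a 0 i) - delta <=
        \sum_(j < #|I|) a 0 (enum_val j) * q.1 0 j * q.2 0 j]].

Definition subadditive_fun (R : realType) (psi : R -> R) : Prop :=
  forall x y, psi (x + y) <= psi x + psi y.

Definition lifted_lhs (R : realType) (n : nat) (I J0 J1 : {set 'I_n})
    (h : 'rV[R]_#|I| * 'rV[R]_#|I| -> R) (gamma : 'I_n -> R^o * R^o -> R)
    (p : 'rV[R]_n * 'rV[R]_n) : R :=
  h (subvec2 I p) +
    \sum_(i in (J0 :|: J1)%SET) gamma i (p.1 0 i, p.2 0 i).

(* Only the values of h on the cube are meaningful, so the domain of
   definition of the left-hand side constrains the coordinates in I only. *)
Definition lifted_dom (R : realType) (n : nat) (I : {set 'I_n}) :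
    set ('rV[R]_n * 'rV[R]_n) :=
  [set p : 'rV[R]_n * 'rV[R]_n | cube2 (subvec2 I p)].

(* Main.v *)
Require Import Defs.
From HB Require Import structures.
From mathcomp Require Import all_boot all_order all_algebra.
From mathcomp Require Import all_classical all_reals all_analysis.
From mathcomp Require Import lra.

(** The lifting function phi(delta) is the largest violation of the seed
    inequality over the points that satisfy the constraint on the coordinates
    in I once it is relaxed by delta.  Releasing x_i, y_i from 0 (for i in
    J0) or from 1 (for i in J1) changes the i-th term of the bilinear
    constraint by w_i := a_i x_i y_i, respectively w_i := a_i x_i y_i - a_i.
    So for a point (x, y) of Q the subvector (x_I, y_I) is feasible for the
    problem defining phi at delta := \sum_i w_i, and hence
      r - h (x_I, y_I) <= phi delta <= psi delta
                       <= \sum_i psi w_i <= \sum_i gamma_i (x_i, y_i),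
    where the third inequality is the extension of subadditivity to finite
    sums, including the empty one thanks to psi 0 = 0.  The point of asking
    for a subadditive upper bound is that this decouples the contributions of
    the lifted variables, so that they can be lifted in any order or all at
    once.

    Concavity of the left-hand side is formal: each summand is a concave
    function precomposed with a linear selection of coordinates, and concave
    functions are stable under linear preimages and finite sums. *)

Set Implicit Arguments.
Unset Strict Implicit.
Unset Printing Implicit Defensive.

Import Order.TTheory GRing.Theory Num.Theory.

Local Open Scope classical_set_scope.
Local Open Scope ring_scope.

Lemma subadditive_fun_sum (R : realType) (psi : R -> R) (T : finType)
    (A : {pred T}) (w : T -> R) :
  subadditive_fun psi -> psi 0 = 0 ->
  psi (\sum_(i in A) w i) <= \sum_(i in A) psi (w i).
Proof.
move=> psiD psi0; elim/big_rec2: _ => [|i y z _ le_zy]; first by rewrite psi0.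
by apply: le_trans (psiD _ _) _; rewrite lerD2l.
Qed.

(** Replaces abstract barycenters by module operations, on which linear maps
    and sums act by rewriting. *)
Lemma concave_functionP (R : numFieldType) (E : lmodType R) (D : set E)
    (f : E -> R) :
  concave_function D f <->
  forall (t : {i01 R}) x y, D x -> D y ->
    t%:num * f x + (1 - t%:num) * f y <= f (t%:num *: x + (1 - t%:num) *: y).
Proof.
split=> [cf t x y Dx Dy|cf t x y].
  have := cf t x y (mem_set Dx) (mem_set Dy).
  by rewrite -convN lerN2.
by rewrite !inE => Dx Dy; rewrite -convN lerN2; exact: cf.
Qed.

Lemma concave_functionD (R : numFieldType) (E : lmodType R) (D : set E)
    (f g : E -> R) :
  concave_function D f -> concave_function D g ->
  concave_function D (fun x => f x + g x).
Proof.
move=> /concave_functionP cf /concave_functionP cg.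
apply/concave_functionP => t x y Dx Dy.
by rewrite !mulrDr addrACA lerD ?cf ?cg.
Qed.

Lemma concave_function_sum (R : numFieldType) (E : lmodType R) (D : set E)
    (T : finType) (A : {pred T}) (f : T -> E -> R) :
  (forall i, i \in A -> concave_function D (f i)) ->
  concave_function D (fun x => \sum_(i in A) f i x).
Proof.
move=> cf; apply/concave_functionP => t x y Dx Dy.
rewrite !mulr_sumr -big_split; apply: ler_sum => i Ai.
by have /concave_functionP := cf i Ai; exact.
Qed.

Lemma concave_function_linear_preimage (R : numFieldType) (E F : lmodType R)
    (D : set F) (f : F -> R) (L : E -> F) :
  linear L -> concave_function D f ->
  concave_function (L @^-1` D) (fun x => f (L x)).
Proof.
move=> linL /concave_functionP cf.
have L0 : L 0 = 0.
  by have := linL (- 1) 0 0; rewrite !scaleN1r !addNr.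
have LZ a u : L (a *: u) = a *: L u.
  by have := linL a u 0; rewrite L0 !addr0.
by apply/concave_functionP => t x y Dx Dy; rewrite linL LZ; exact: cf.
Qed.

Lemma concave_functionS (R : numFieldType) (E : lmodType R) (D D' : set E)
    (f : E -> R) :
  D' `<=` D -> concave_function D f -> concave_function D' f.
Proof.
move=> D'D /concave_functionP cf.
by apply/concave_functionP => t x y /D'D Dx /D'D Dy; exact: cf.
Qed.

Lemma linear_subvec2 (R : realType) (n : nat) (I : {set 'I_n}) :
  linear (@subvec2 R n I).
Proof.
by move=> t [x1 y1] [x2 y2]; congr pair; apply/rowP => j; rewrite !mxE.
Qed.

Lemma linear_coord2 (R : realType) (n : nat) (i : 'I_n) :
  linear ((fun p => (p.1 0 i, p.2 0 i)) :
    'rV[R]_n * 'rV[R]_n -> R^o * R^o).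
Proof. by move=> t [x1 y1] [x2 y2]; congr pair; rewrite !mxE. Qed.

Lemma concave_lifted_lhs (R : realType) (n : nat) (I J0 J1 : {set 'I_n})
    (h : 'rV[R]_#|I| * 'rV[R]_#|I| -> R) (gamma : 'I_n -> R^o * R^o -> R) :
  concave_function (@cube2 R #|I|) h ->
  (forall i, i \in J0 :|: J1 -> concave_function [set: R^o * R^o] (gamma i)) ->
  concave_function (@lifted_dom R n I) (lifted_lhs J0 J1 h gamma).
Proof.
move=> ch cgamma; apply: concave_functionD.
  exact: concave_function_linear_preimage (@linear_subvec2 R n I) ch.
apply: concave_function_sum => i Ji.
apply: concave_functionS (concave_function_linear_preimage
  (@linear_coord2 R n i) (cgamma i Ji)).
by [].
Qed.

Lemma big_disjoint_setU (R : nmodType) (T : finType) (A B : {set T})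
    (F : T -> R) :
  [disjoint A & B]%B ->
  \sum_(i in (A :|: B)%SET) F i = \sum_(i in A) F i + \sum_(i in B) F i.
Proof.
by move=> dAB; rewrite -bigU//; apply: eq_bigl => i; rewrite !inE.
Qed.

Lemma sum_partition3 (R : nmodType) (T : finType) (I J0 J1 : {set T})
    (F : T -> R) :
  partition3 I J0 J1 ->
  \sum_i F i =
    \sum_(i in I) F i + \sum_(i in J0) F i + \sum_(i in J1) F i.
Proof.
case=> cov dI0 dI1 d01; rewrite -!big_disjoint_setU//.
  by rewrite cov; apply: eq_bigl => i; rewrite !inE.
rewrite finset.disjoints_subset finset.subUset -!finset.disjoints_subset.
by rewrite dI1 d01.
Qed.

Lemma cube2_subvec2 (R : realType) (n : nat) (I : {set 'I_n})
    (p : 'rV[R]_n * 'rV[R]_n) :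
  cube2 p -> cube2 (subvec2 I p).
Proof. by move=> cp j; rewrite /= !mxE; exact: cp. Qed.

(** The subtracted constant is the value of the i-th bilinear term when both
    variables are held at 0 (index in J0) or at 1 (index in J1). *)
Definition lifting_shift (R : realType) (n : nat) (a : 'rV[R]_n)
    (J1 : {set 'I_n}) (p : 'rV[R]_n * 'rV[R]_n) (i : 'I_n) : R :=
  a 0 i * p.1 0 i * p.2 0 i - (if i \in J1 then a 0 i else 0).

(** The subvector of a point of Q is feasible for the lifting problem at the
    total shift: subtracting the terms outside I from the constraint of Q
    leaves exactly the constraint of that problem. *)
Lemma seed_gap_le_lifting_fun (R : realType) (n : nat) (a : 'rV[R]_n) (d : R)
    (I J0 J1 : {set 'I_n}) (h : 'rV[R]_#|I| * 'rV[R]_#|I| -> R) (r : R)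
    (p : 'rV[R]_n * 'rV[R]_n) :
  partition3 I J0 J1 -> bilinear_set a d p ->
  ((r - h (subvec2 I p))%:E <=
    lifting_fun a d J1 h r
      (\sum_(i in (J0 :|: J1)%SET) lifting_shift a J1 p i))%E.
Proof.
move=> part [cp dp]; apply: ereal_sup_ubound.
exists (subvec2 I p) => //; split; first exact: cube2_subvec2.
have [_ _ _ d01] := part.
under [X in _ <= X]eq_bigr do rewrite /= !mxE.
rewrite -(big_enum_val (fun i => a 0 i * p.1 0 i * p.2 0 i)).
rewrite big_disjoint_setU//.
have -> : \sum_(i in J0) lifting_shift a J1 p i =
    \sum_(i in J0) a 0 i * p.1 0 i * p.2 0 i.
  by apply: eq_bigr => i J0i; rewrite /lifting_shift (disjointFr d01)// subr0.
have -> : \sum_(i in J1) lifting_shift a J1 p i =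
    \sum_(i in J1) a 0 i * p.1 0 i * p.2 0 i - \sum_(i in J1) a 0 i.
  by rewrite -sumrB; apply: eq_bigr => i J1i; rewrite /lifting_shift J1i.
by move: dp; rewrite (sum_partition3 _ part); lra.
Qed.

Theorem proposition1 (R : realType) (n : nat) (a : 'rV[R]_n) (d : R)
    (I J0 J1 : {set 'I_n})
    (h : 'rV[R]_#|I| * 'rV[R]_#|I| -> R) (r : R)
    (psi : R -> R) (gamma : 'I_n -> R^o * R^o -> R) :
  partition3 I J0 J1 ->
  concave_function (@cube2 R #|I|) h ->
  valid_ineq (bilinear_restr a d J0 J1) (fun p => h (subvec2 I p)) r ->
  (forall i, i \in J0 :|: J1 -> concave_function [set: R^o * R^o] (gamma i)) ->
  (forall delta, (lifting_fun a d J1 h r delta <= (psi delta)%:E)%E) ->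
  subadditive_fun psi ->
  psi 0 = 0 ->
  (forall i, i \in J0 -> forall x y : R, 0 <= x <= 1 -> 0 <= y <= 1 ->
     psi (a 0 i * x * y) <= gamma i (x, y)) ->
  (forall i, i \in J1 -> forall x y : R, 0 <= x <= 1 -> 0 <= y <= 1 ->
     psi (a 0 i * x * y - a 0 i) <= gamma i (x, y)) ->
  valid_ineq (bilinear_set a d) (lifted_lhs J0 J1 h gamma) r /\
  concave_function (@lifted_dom R n I) (lifted_lhs J0 J1 h gamma).
Proof.
move=> part ch _ cgamma psi_ge psiD psi0 gamma0 gamma1.
split; last exact: concave_lifted_lhs.
move=> p Qp; rewrite /lifted_lhs -lerBlDl -lee_fin.
apply: le_trans (seed_gap_le_lifting_fun h r part Qp) _.
apply: le_trans (psi_ge _) _; rewrite lee_fin.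
apply: le_trans (subadditive_fun_sum _ _ psiD psi0) _.
have [_ _ _ d01] := part.
apply: ler_sum => i; have [xi yi] := Qp.1 i; rewrite /lifting_shift inE.
case/orP => Ji; last by rewrite Ji; exact: gamma1.
by rewrite (disjointFr d01)// subr0; exact: gamma0.
Qed.
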